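(* For each $a,b>0$ let $X_{a,b}\sim\mathrm{Beta}(a,b)$. Then the mapping $(a,b)\mapsto\mathbb{P}(X_{a,b}\ge\mathbb{E}(X_{a,b}))$, defined for $a,b>0$, is increasing in $a$ (for each fixed $b$) and decreasing in $b$ (for each fixed $a$).
   Context: For $a,b>0$, $\mathrm{Beta}(a,b)$ is the distribution on $[0,1]$ with density $x^{a-1}(1-x)^{b-1}/\mathrm{B}(a,b)$ for $x\in(0,1)$, where $\mathrm{B}(a,b)=\int_0^1 y^{a-1}(1-y)^{b-1}\,dy$. ''Increasing'' and ''decreasing'' are meant in the weak (non-strict) sense. *)

(* Defs.v *)
(* MathComp-Analysis *)
From HB Require Import structures.
From mathcomp Require Import all_boot all_order all_algebra.
From mathcomp Require Import all_classical all_reals all_analysis.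

Set Implicit Arguments.
Unset Strict Implicit.
Unset Printing Implicit Defensive.

Import Order.TTheory GRing.Theory Num.Theory.
Import numFieldNormedType.Exports.

Local Open Scope classical_set_scope.
Local Open Scope ring_scope.

(* The library's beta_fun, beta_pdf and beta_prob only allow parameters in nat;
   the counterparts below take real parameters. *)

(* Integrating over the open interval avoids the endpoints, where the integrand
   may be singular (and where powR has the convention 0 `^ x = 0 for x != 0). *)
Definition Beta {R : realType} (a b : R) : R :=
  \int[lebesgue_measure]_(y in `]0, 1[) (y `^ (a - 1) * (1 - y) `^ (b - 1)).

Definition Beta_pdf {R : realType} (a b : R) : R -> R :=
  (fun x : R => x `^ (a - 1) * (1 - x) `^ (b - 1) / Beta a b) \_ `]0, 1[.

Definition Beta_distributed {R : realType} d (T : measurableType d)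
    (P : probability T R) (X : {RV P >-> R}) (a b : R) : Prop :=
  forall A : set R, measurable A ->
    distribution P X A = (\int[lebesgue_measure]_(x in A) (Beta_pdf a b x)%:E)%E.

Definition prob_ge_mean {R : realType} d (T : measurableType d)
    (P : probability T R) (X : {RV P >-> R}) : \bar R :=
  P [set w | ('E_P[X] <= (X w)%:E)%E].

(* Main.v *)
(* Write w(x) = x^(a-1) (1-x)^(b-1), m = a/(a+b), U and B for the integrals of w
   over (0,m) and (0,1). The probability is 1 - U/B, so monotonicity in a means
   (U/B)' <= 0; the reflection x -> 1 - x exchanges a and b and gives the rest.
   Differentiating under the integral, and using Stein's identity
   (x (1-x) w)' = (a+b) (m-x) w to absorb the boundary term w(m) m', the inequality
   becomes E[h | x > m] <= E[h | x < m], where h(x) = y - 1 - ln y and y = x/m.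
   By ln y <= 2 (y-1)/(y+1) for y <= 1, and >= for y >= 1, h is at least
   (y-1) (ln y) / 2 left of m and at most that right of m. Integrating
   (y-1) (ln y) w by parts against V = x^a (1-x)^b ln y turns it into
   (1-x) w / a, so (1-m)/(2a) separates the two conditional expectations. *)
Require Import Defs.
From HB Require Import structures.
From mathcomp Require Import all_boot all_order all_algebra.
From mathcomp Require Import all_classical all_reals all_analysis.
From mathcomp Require Import measurable_realfun ring lra.

Set Implicit Arguments.
Unset Strict Implicit.
Unset Printing Implicit Defensive.

Import Order.TTheory GRing.Theory Num.Theory.
Import numFieldNormedType.Exports.

Local Open Scope classical_set_scope.
Local Open Scope ring_scope.

(** * Calculus on open intervals *)

Section generic_analysis.
Context {R : realType}.
Notation mu := (@lebesgue_measure R).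

Lemma integrable_itv_bndoo (c d : R) (b0 b1 : bool) (f : R -> R) :
  mu.-integrable `]c, d[ (EFin \o f) ->
  mu.-integrable [set` Interval (BSide b0 c) (BSide b1 d)] (EFin \o f).
Proof.
move=> /integrableP[mf fi].
have mf' : measurable_fun `[c, d] f.
  by apply: (@measurable_fun_itv_cc _ c d false true f); exact/measurable_EFinP.
apply: (@integrableS _ _ _ mu `[c, d]) => //.
  by apply: subset_itv; rewrite bnd_simp; [case: b0|case: b1].
apply/integrableP; split; first exact/measurable_EFinP.
by rewrite integral_itv_bndoo//; exact: measurableT_comp.
Qed.

(** The integrands below may blow up at the endpoints, so only one-sided limits of [G] are required
    there. Integrability makes the indefinite integral [F] of [f] continuous up to both ends, and
    [G - F] has zero derivative inside, hence is constant; the limits then carry this to [c] and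
    [d]. *)
Lemma Rintegral_FTC_oo (f G : R -> R) (c d lc ld : R) : c < d ->
  mu.-integrable `]c, d[ (EFin \o f) -> {in `]c, d[, continuous f} ->
  (forall x : R, x \in `]c, d[ -> is_derive x 1 G (f x)) ->
  G x @[x --> c^'+] --> lc -> G x @[x --> d^'-] --> ld ->
  \int[mu]_(x in `]c, d[) f x = ld - lc.
Proof.
move=> cd fi cf dG Glc Gld.
have fi' := @integrable_itv_bndoo c d true false f fi.
pose F x := \int[mu]_(t in `[c, x]) f t.
have cF : {within `[c, d], continuous F}.
  exact: parameterized_integral_continuous (ltW cd) fi'.
have [cFo Fc Fd] := (continuous_within_itvP F cd).1 cF.
have dF x : x \in `]c, d[ -> is_derive x 1 F (f x).
  move=> xcd; move: (xcd); rewrite in_itv/= => /andP[cx xd].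
  have [dx d1] := @continuous_FTC1_closed _ f c x d xd fi' cx (cf _ xcd).
  by rewrite -d1 derive1E; apply/derivableP; exact: dx.
have -> : \int[mu]_(x in `]c, d[) f x = F d.
  rewrite Rintegral_itv_bndo_bndc//; first exact: Rintegral_itv_obnd_cbnd (@integrable_itv_bndoo c d false false f fi).
have F0 : F c = 0 by rewrite /F set_itv1 Rintegral_set1.
have dGF x : x \in `]c, d[ -> is_derive x 1 (fun y => G y - F y) 0.
  by move=> xcd; rewrite -(subrr (f x)); apply: is_deriveB; [exact: dG|exact: dF].
pose p := (c + d) / 2.
have pcd : p \in `]c, d[ by rewrite in_itv/= /p; lra.
have GFE x : x \in `]c, d[ -> G x = F x + (G p - F p).
  move=> xcd; suff : G x - F x = G p - F p by lra.
  wlog xp : x p xcd pcd / x <= p => [hw|].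
    have [|/ltW] := leP x p; first exact: hw.
    by move=> px; apply/esym/hw.
  have sub : {subset `[x, p] <= `]c, d[}.
    move=> y; rewrite !in_itv/= => /andP[xy yp].
    by rewrite (lt_le_trans _ xy) ?(itvP xcd)// (le_lt_trans yp) ?(itvP pcd).
  have dH y : y \in `]x, p[ -> is_derive y 1 (fun y => G y - F y) ((fun=> 0) y).
    by move=> /subset_itv_oo_cc /sub ycd; exact: (dGF _ ycd).
  have cH : {within `[x, p], continuous (fun y => G y - F y)}.
    apply: derivable_within_continuous => y /sub ycd.
    exact: (@ex_derive _ _ _ _ _ _ _ (dGF _ ycd)).
  have [z _ /=] := @MVT_segment R _ _ _ _ xp dH cH.
  by rewrite mul0r; lra.
have Ec : lc = F c + (G p - F p).
  apply: (@cvg_unique _ (@norm_hausdorff _ R^o) _ _ lc _ Glc).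
  apply: cvg_trans (cvgD Fc (cvg_cst (G p - F p))).
  apply: near_eq_cvg; near=> x; apply/esym/GFE; rewrite in_itv/=.
  by apply/andP; split; near: x; [exact: nbhs_right_gt|exact: nbhs_right_lt].
have Ed : ld = F d + (G p - F p).
  apply: (@cvg_unique _ (@norm_hausdorff _ R^o) _ _ ld _ Gld).
  apply: cvg_trans (cvgD Fd (cvg_cst (G p - F p))).
  apply: near_eq_cvg; near=> x; apply/esym/GFE; rewrite in_itv/=.
  by apply/andP; split; near: x; [exact: nbhs_left_gt|exact: nbhs_left_lt].
by rewrite Ec Ed F0; ring.
Unshelve. all: by end_near. Qed.

(** On each closed subinterval the integral of [f] is an increment of [G], hence at most [2 * M];
    since [f >= 0], monotone convergence along an exhaustion carries this bound to the open
    interval. *)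
Lemma integrable_bounded_primitive (f G : R -> R) (c d M : R) : c < d ->
  {in `]c, d[, forall x, 0 <= f x} -> {in `]c, d[, continuous f} ->
  (forall x : R, x \in `]c, d[ -> is_derive x 1 G (f x)) ->
  {in `]c, d[, forall x, `|G x| <= M} ->
  mu.-integrable `]c, d[ (EFin \o f).
Proof.
move=> cd f0 cf dG GM.
have mf : measurable_fun `]c, d[ f.
  apply: open_continuous_measurable_fun; first exact: interval_open.
  by move=> x; rewrite inE => xcd; exact: cf.
apply/integrableP; split; first exact/measurable_EFinP.
pose F (n : nat) : set R := `[c + n.+1%:R^-1, d - n.+1%:R^-1]%classic.
have e0 n : 0 < n.+1%:R^-1 :> R by rewrite invr_gt0.
have ndF : {homo F : n m / (n <= m)%N >-> (n <= m)%O}.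
  move=> n m nm; apply/subsetPset => x; rewrite /F/= !in_itv/= => /andP[cx xd].
  have : m.+1%:R^-1 <= n.+1%:R^-1 :> R by rewrite lef_pV2 ?posrE// ler_nat.
  move: (m.+1%:R^-1) (n.+1%:R^-1) cx xd => u v; lra.
have UF : \bigcup_n F n = `]c, d[%classic.
  apply/seteqP; split => x.
    by move=> [n _]; rewrite /F/= !in_itv/=; move: (n.+1%:R^-1) (e0 n) => u; lra.
  rewrite /= in_itv/= => /andP[/ltr_add_invr[k ck] /ltr_add_invr[l ld]].
  exists (maxn k l) => //; rewrite /F/= in_itv/=.
  have : (maxn k l).+1%:R^-1 <= k.+1%:R^-1 :> R.
    by rewrite lef_pV2 ?posrE// ler_nat ltnS leq_maxl.
  have : (maxn k l).+1%:R^-1 <= l.+1%:R^-1 :> R.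
    by rewrite lef_pV2 ?posrE// ler_nat ltnS leq_maxr.
  move: ((maxn k l).+1%:R^-1) (k.+1%:R^-1) (l.+1%:R^-1) ck ld => u v w; lra.
have Fcd n : F n `<=` `]c, d[ by rewrite -UF; exact: bigcup_sup.
have mF n : measurable (F n) by exact: measurable_itv.
have f0' n x : F n x -> (0 <= (EFin \o f) x)%E.
  by move=> /Fcd xcd; rewrite lee_fin f0.
have mfF n : measurable_fun (F n) (EFin \o f).
  by apply/measurable_EFinP; apply: measurable_funS mf => //; exact: Fcd.
have H : (\int[mu]_(x in F n) (EFin \o f) x)%E @[n --> \oo] -->
    (\int[mu]_(x in `]c, d[) (f x)%:E)%E.
  by rewrite -UF; exact: ge0_nondecreasing_set_cvg_integral.
under eq_integral => x xcd.
  rewrite /= ger0_norm; last by apply: f0; rewrite inE in xcd.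
  over.
apply: (@le_lt_trans _ _ (2 * M)%:E); last exact: ltry.
have -> : (\int[mu]_(x in `]c, d[) (f x)%:E)%E = limn (fun n => \int[mu]_(x in F n) (EFin \o f) x)%E.
  by apply/esym/cvg_lim => //; exact: H.
have M0 : 0 <= M.
  apply: le_trans (GM ((c + d) / 2) _); first exact: normr_ge0.
  by rewrite in_itv/=; lra.
apply: lime_le; first by apply/cvg_ex; eexists; exact: H.
apply: nearW => n; rewrite /F.
(* For small [n] the interval [F n] may be a point or empty; its integral is then 0. *)
have [cd'|dc'] := ltP (c + n.+1%:R^-1) (d - n.+1%:R^-1); last first.
  rewrite le_eqVlt in dc'; case/predU1P : dc' => [->|dc'].
    by rewrite set_itv1 integral_set1 lee_fin mulr_ge0.
  by rewrite set_itv_ge ?integral_set0 ?lee_fin ?mulr_ge0// bnd_simp -ltNge.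
have sub x : x \in `[c + n.+1%:R^-1, d - n.+1%:R^-1] -> x \in `]c, d[ by exact: (@Fcd n).
have dGx x : x \in `[c + n.+1%:R^-1, d - n.+1%:R^-1] -> derivable G x 1.
  by move=> /sub xcd; exact: (@ex_derive _ _ _ _ _ _ _ (dG _ xcd)).
have cG : {within `[c + n.+1%:R^-1, d - n.+1%:R^-1], continuous G}.
  exact: derivable_within_continuous.
have [_ Gc Gd] := (continuous_within_itvP G cd').1 cG.
rewrite (@continuous_FTC2 _ f G)//.
- rewrite -EFinB lee_fin.
  have /GM : d - n.+1%:R^-1 \in `]c, d[ by rewrite in_itv/=; move: (n.+1%:R^-1) (e0 n) cd' => u; lra.
  have /GM : c + n.+1%:R^-1 \in `]c, d[ by rewrite in_itv/=; move: (n.+1%:R^-1) (e0 n) cd' => u; lra.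
  by rewrite !ler_norml; lra.
- by move=> x; apply: continuous_in_subspaceT => y; rewrite inE => /sub /cf.
- by split => // x /subset_itv_oo_cc /dGx.
- move=> x /subset_itv_oo_cc /sub xcd; rewrite derive1E.
  exact: (@derive_val _ _ _ _ _ _ _ (dG _ xcd)).
Qed.

(* The mean value theorem in the second variable turns the increment along the
   moving endpoint [m] into [F2] evaluated at a nearby point. *)
Lemma is_derive_diag (F F2 : R -> R -> R) (m : R -> R) (a D1 m' : R) :
  is_derive a 1 (fun t => F t (m a)) D1 ->
  (\forall t \near a, forall x, x \in `[Num.min (m a) (m t), Num.max (m a) (m t)] ->
    is_derive x 1 (F t) (F2 t x)) ->
  (forall t_ x_ : R -> R, t_ h @[h --> 0^'] --> a -> x_ h @[h --> 0^'] --> m a ->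
    F2 (t_ h) (x_ h) @[h --> 0^'] --> F2 a (m a)) ->
  is_derive a 1 m m' ->
  is_derive a 1 (fun t => F t (m t)) (D1 + F2 a (m a) * m').
Proof.
move=> [dF1 DF1] nF cF2 [dm Dm].
have cm : {for a, continuous m} by exact/differentiable_continuous/derivable1_diffP.
(* A mean value point [xi t] is chosen for every [t], on the interval between [m a] and [m t] in
   either order. Where the differentiability hypothesis fails, the condition on [xi t] is vacuous
   and 0 is a dummy value. *)
have /choice[xi xiP] : forall t, exists x,
    (forall x, x \in `[Num.min (m a) (m t), Num.max (m a) (m t)] ->
       is_derive x 1 (F t) (F2 t x)) ->
    x \in `[Num.min (m a) (m t), Num.max (m a) (m t)] /\
    F t (m t) - F t (m a) = F2 t x * (m t - m a).
  move=> t.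
  have [H|H] := pselect (forall x, x \in `[Num.min (m a) (m t), Num.max (m a) (m t)] ->
       is_derive x 1 (F t) (F2 t x)); last by exists 0.
  have cF : {within `[Num.min (m a) (m t), Num.max (m a) (m t)], continuous (F t)}.
    apply: derivable_within_continuous => x xat.
    exact: (@ex_derive _ _ _ _ _ _ _ (H _ xat)).
  have le : Num.min (m a) (m t) <= Num.max (m a) (m t) by rewrite ge_min le_max lexx.
  have [x xat E] := MVT_segment le (fun x xi => H x (subset_itv_oo_cc xi)) cF.
  exists x => _; split => //.
  move: E; have [mat|mta] := leP (m a) (m t) => // E.
  by rewrite -[LHS]opprB E -mulrN opprB.
have cvga : h + a @[h --> 0^'] --> a.
  rewrite -[X in _ --> X]add0r; apply: cvgD; last exact: cvg_cst.
  exact: cvg_within.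
have cvgm : m (h + a) @[h --> 0^'] --> m a by exact: (cvg_comp _ _ cvga cm).
have cvgxi : xi (h + a) @[h --> 0^'] --> m a.
  have cvgd : `|m (h + a) - m a| @[h --> 0^'] --> 0.
    have := cvg_norm (cvgB cvgm (cvg_cst (m a))); rewrite subrr normr0 => H; exact: H.
  apply: (@squeeze_cvgr _ _ _ _ (fun h => m a - `|m (h + a) - m a|)
    (fun h => m a + `|m (h + a) - m a|)).
  - near=> h.
    have /xiP[+ _] : (forall x, x \in `[Num.min (m a) (m (h + a)), Num.max (m a) (m (h + a))] ->
       is_derive x 1 (F (h + a)) (F2 (h + a) x)) by near: h; exact: (cvga _ nF).
    by rewrite in_itv/=; have [le|le] := leP (m a) (m (h + a));
      [rewrite ger0_norm ?subr_ge0//|rewrite ltr0_norm ?subr_lt0//]; lra.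
  - by rewrite -[X in _ --> X]subr0; apply: cvgB cvgd; exact: cvg_cst.
  - by rewrite -[X in _ --> X]addr0; apply: cvgD cvgd; exact: cvg_cst.
have cvgq : h^-1 *: (F (h + a) (m (h + a)) - F a (m a)) @[h --> 0^'] --> D1 + F2 a (m a) * m'.
  have c1 : h^-1 *: (F (h *: 1 + a) (m a) - F a (m a)) @[h --> 0^'] --> D1.
    by rewrite -DF1; exact: dF1.
  have c2 : h^-1 *: (m (h *: 1 + a) - m a) @[h --> 0^'] --> m'.
    by rewrite -Dm; exact: dm.
  (* The increment is split at [F (h + a) (m a)]: the first part moves only the parameter, the
     second only the endpoint, and [xi] rewrites the second. *)
  have c3 : h^-1 * (F (h * 1 + a) (m a) - F a (m a)) +
      F2 (h + a) (xi (h + a)) * (h^-1 * (m (h * 1 + a) - m a)) @[h --> 0^'] -->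
      D1 + F2 a (m a) * m'.
    apply: cvgD; first exact: c1.
    by apply: cvgM; [exact: cF2 cvga cvgxi|exact: c2].
  apply: cvg_trans c3; apply: near_eq_cvg; near=> h => /=.
  have /xiP[_ E] : (forall x, x \in `[Num.min (m a) (m (h + a)), Num.max (m a) (m (h + a))] ->
       is_derive x 1 (F (h + a)) (F2 (h + a) x)) by near: h; exact: (cvga _ nF).
  by rewrite /GRing.scale/= mulr1 mulrCA -E; ring.
split.
  apply/cvg_ex; exists (D1 + F2 a (m a) * m').
  by under eq_fun do rewrite /GRing.scale/= mulr1; exact: cvgq.
rewrite /derive; under eq_fun do rewrite /GRing.scale/= mulr1.
by apply/cvg_lim; first exact: norm_hausdorff; exact: cvgq.
Unshelve. all: by end_near. Qed.

End generic_analysis.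

(** * The Beta kernel *)

Section beta_kernel.
Context {R : realType}.
Notation mu := (@lebesgue_measure R).
Implicit Types a b x m : R.

(** With these exponents it is, on (0,1), [x * (1 - x)] times the weight, the function
    differentiated in Stein's identity; the weight itself is the same family with both exponents
    lowered by one. *)
Definition beta_bump a b x : R := x `^ a * (1 - x) `^ b.

(** Convertible to the integrand of [Beta a b], so results on its integral over (0,1) apply to
    [Beta] directly. *)
Definition beta_kernel a b : R -> R := beta_bump (a - 1) (b - 1).

Lemma beta_bump_ge0 a b x : 0 <= beta_bump a b x.
Proof. by rewrite mulr_ge0 ?powR_ge0. Qed.

Lemma beta_bump_gt0 a b x : 0 < x < 1 -> 0 < beta_bump a b x.
Proof. by move=> ?; rewrite mulr_gt0 ?powR_gt0//; lra. Qed.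

Lemma beta_kernel_ge0 a b x : 0 <= beta_kernel a b x.
Proof. exact: beta_bump_ge0. Qed.

Lemma powR_predK a x : 0 < x -> x `^ a = x * x `^ (a - 1).
Proof.
move=> x0; rewrite powRB; last by apply/implyP => _; rewrite gt_eqF.
have xn0 : x != 0 by rewrite gt_eqF.
by rewrite powRr1 ?ltW// mulrCA divff// mulr1.
Qed.

Lemma continuous_powR_gt0 a x : 0 < x -> {for x, continuous (fun y : R => y `^ a)}.
Proof.
move=> x0; apply/differentiable_continuous/derivable1_diffP.
by apply: derivable_powR; rewrite in_itv/= x0.
Qed.

Lemma continuous_onem_powR a x : x < 1 ->
  {for x, continuous (fun y : R => (1 - y) `^ a)}.
Proof.
move=> x1; apply: (@continuous_comp _ _ _ (fun y : R => 1 - y) (fun y : R => y `^ a)).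
  by apply: cvgB; [exact: cvg_cst|exact: cvg_id].
by apply: continuous_powR_gt0; rewrite subr_gt0.
Qed.

Lemma is_derive_onem_powR b x : x < 1 ->
  is_derive x 1 (fun y : R => (1 - y) `^ b) (- (b * (1 - x) `^ (b - 1))).
Proof.
move=> x1; have y0 : 0 < 1 - x by rewrite subr_gt0.
have d1 : is_derive x 1 (fun y : R => 1 - y) (0 - 1).
  exact: is_deriveB.
have := @is_derive1_comp R (fun y : R => y `^ b) (fun y => 1 - y) x _ _ (is_derive1_powR b y0) d1.
by move=> H; apply: (is_derive_eq H); ring.
Qed.

(** Stein's identity in differential form: for positive parameters the factor is
    [(a + b) * (m - x)]. The exponents are arbitrary reals, so this also gives continuity of the
    kernel, whose exponents may be negative. *)
Lemma is_derive_beta_bump a b x : 0 < x < 1 ->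
  is_derive x 1 (beta_bump a b) ((a - (a + b) * x) * beta_kernel a b x).
Proof.
move=> /andP[x0 x1].
have y0 : 0 < 1 - x by rewrite subr_gt0.
have d1 := is_derive_onem_powR b x1.
have := is_deriveM (is_derive1_powR a x0) d1.
move=> H; apply: (is_derive_eq H).
rewrite /GRing.scale/= /beta_kernel /beta_bump (powR_predK a x0) (powR_predK b y0).
ring.
Qed.

Lemma continuous_beta_bump a b : {in `]0, 1[, continuous (beta_bump a b)}.
Proof.
move=> x; rewrite in_itv/= => x01.
apply/differentiable_continuous/derivable1_diffP.
exact: (@ex_derive _ _ _ _ _ _ _ (is_derive_beta_bump a b x01)).
Qed.

Lemma measurable_beta_kernel a b : measurable_fun [set: R] (beta_kernel a b).
Proof.
apply: measurable_funM; first exact: measurable_powR.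
apply: (@measurableT_comp _ _ _ _ _ _ (fun y : R => y `^ (b - 1))).
  exact: measurable_powR.
exact: measurable_funB.
Qed.

Lemma onem_cvg0 : (fun x : R => 1 - x) @ 1^'- --> 0^'+.
Proof.
move=> P [e /= e0 eP]; exists e => //= x x1e xlt.
apply: eP; last by rewrite subr_gt0.
by rewrite /= sub0r normrN.
Qed.

Lemma beta_bump_cvg0 a b : 0 < a -> beta_bump a b x @[x --> 0^'+] --> 0.
Proof.
move=> a0; rewrite -[X in _ --> X](mul0r ((1 - 0) `^ b)); apply: cvgM.
  exact: powR_cvg0.
apply: cvg_at_right_filter.
exact: continuous_onem_powR.
Qed.

Lemma beta_bump_sym a b x : beta_bump a b (1 - x) = beta_bump b a x.
Proof. by rewrite /beta_bump subKr mulrC. Qed.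

Lemma beta_bump_cvg1 a b : 0 < b -> beta_bump a b x @[x --> 1^'-] --> 0.
Proof.
move=> b0; have := cvg_comp _ _ onem_cvg0 (beta_bump_cvg0 a b0).
by apply: cvg_trans; apply: near_eq_cvg; near=> x; rewrite /= beta_bump_sym.
Unshelve. all: by end_near. Qed.

(* [1 + u <= exp u] at [u = - (a / 2) * ln x]. *)
Lemma ln_powR_le a x : 0 < a -> 0 < x < 1 ->
  `|ln x| * x `^ a <= 2 / a * x `^ (a / 2).
Proof.
move=> a0 /andP[x0 x1].
have lx : ln x < 0 by rewrite ln_lt0// x0.
have -> : x `^ a = x `^ (a / 2) * x `^ (a / 2).
  rewrite -powRD; last by apply/implyP => _; rewrite gt_eqF.
  by congr (powR x _); field.
rewrite mulrA ler_pM2r ?powR_gt0// ltr0_norm//.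
have := expR_ge1Dx (- (a / 2) * ln x).
rewrite -[_ * ln x]mulrC.
have -> : expR (ln x * - (a / 2)) = (x `^ (a / 2))^-1.
  by rewrite mulrN expRN mulrC /powR gt_eqF.
move=> H; have p0 : 0 < x `^ (a / 2) by exact: powR_gt0.
have {}H : (1 + ln x * - (a / 2)) * x `^ (a / 2) <= 1.
  by rewrite -ler_pdivlMr// div1r.
rewrite ler_pdivlMr//; move: (x `^ (a / 2)) (ln x) p0 H => q l; lra.
Qed.

(** Half of the exponent absorbs the logarithm: [ln_powR_le] bounds [x ^ a * |ln x|] by a multiple
    of [x ^ (a / 2)]. *)
Lemma beta_bump_ln_cvg0 a b m : 0 < a ->
  beta_bump a b x * (ln x - ln m) @[x --> 0^'+] --> 0.
Proof.
move=> a0.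
have H : x `^ a * ln x @[x --> 0^'+] --> 0.
  apply: norm_cvg0.
  apply: (@squeeze_cvgr _ _ _ _ (fun=> 0) (fun x => 2 / a * x `^ (a / 2))).
  - near=> x; rewrite normr_ge0/= normrM mulrC (ger0_norm (powR_ge0 _ _)).
    apply: ln_powR_le => //; apply/andP; split; near: x; first exact: nbhs_right_gt.
    exact: nbhs_right_lt.
  - exact: cvg_cst.
  - rewrite -[X in _ --> X](mulr0 (2 / a)); apply: cvgM; first exact: cvg_cst.
    by apply: powR_cvg0; rewrite divr_gt0.
have H1 : (1 - x) `^ b @[x --> 0^'+] --> (1 - 0) `^ b.
  apply: cvg_at_right_filter.
  exact: continuous_onem_powR.
have H2 : (x `^ a * ln x - x `^ a * ln m) * (1 - x) `^ b @[x --> 0^'+] -->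
    (0 - 0 * ln m) * (1 - 0) `^ b.
  apply: cvgM H1; apply: cvgB; first exact: H.
  by apply: cvgM; [exact: powR_cvg0|exact: cvg_cst].
rewrite mul0r subr0 mul0r in H2.
apply: cvg_trans H2; apply: near_eq_cvg; near=> x; rewrite /beta_bump; ring.
Unshelve. all: by end_near. Qed.

Lemma beta_bump_ln_cvg1 a b m : 0 < b ->
  beta_bump a b x * (ln x - ln m) @[x --> 1^'-] --> 0.
Proof.
move=> b0; rewrite -[X in _ --> X](mul0r (ln 1 - ln m)); apply: cvgM.
  exact: beta_bump_cvg1.
apply: cvgB; last exact: cvg_cst.
by apply: cvg_at_left_filter; apply: continuous_ln.
Qed.

(** The two singularities are separated by the majorant [x ^ (a - 1) + (1 - x) ^ (b - 1)], whose
    primitive [x ^ a / a - (1 - x) ^ b / b] is bounded by [1 / a + 1 / b]. *)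
Lemma integrable_beta_kernel a b : 0 < a -> 0 < b ->
  mu.-integrable `]0, 1[ (EFin \o beta_kernel a b).
Proof.
move=> a0 b0.
pose f x := x `^ (a - 1) + (1 - x) `^ (b - 1).
have f0 x : 0 <= f x by rewrite addr_ge0 ?powR_ge0.
have p1 c x : 0 < c -> 0 < x < 1 -> 0 <= x `^ c <= 1.
  move=> c0 /andP[x0 x1]; rewrite powR_ge0/= -[leRHS](powRr0 x).
  by apply: ger_powR; [rewrite x0 ltW|exact: ltW].
have : mu.-integrable `]0, 1[ (EFin \o f).
  apply: (@integrable_bounded_primitive R f
    (fun x => a^-1 * x `^ a - b^-1 * (1 - x) `^ b) 0 1 (a^-1 + b^-1) ltr01).
  - by move=> x _; exact: f0.
  - move=> x; rewrite in_itv/= => /andP[x0 x1]; apply: cvgD.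
      exact: continuous_powR_gt0.
    exact: continuous_onem_powR.
  - move=> x; rewrite in_itv/= => /andP[x0 x1].
    have y0 : 0 < 1 - x by rewrite subr_gt0.
    have d1 := is_derive_onem_powR b x1.
    have := is_deriveB (is_deriveZ a^-1 (is_derive1_powR a x0)) (is_deriveZ b^-1 d1).
    move=> H; apply: (is_derive_eq H); rewrite /GRing.scale/= /f; field.
    by rewrite !gt_eqF.
  - move=> x; rewrite in_itv/= => x01.
    have y01 : 0 < 1 - x < 1 by lra.
    have ia : 0 < a^-1 by rewrite invr_gt0.
    have ib : 0 < b^-1 by rewrite invr_gt0.
    have := p1 _ _ a0 x01; have := p1 _ _ b0 y01.
    move: (x `^ a) (_ `^ b) (a^-1) (b^-1) ia ib => p q u v u0 v0 q1 p1'.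
    by rewrite ler_norml; nra.
apply: le_integrable => //.
  apply/measurable_EFinP; apply: measurable_funTS; exact: measurable_beta_kernel.
move=> x; rewrite /= in_itv/= => x01; rewrite !ger0_norm ?f0 ?beta_kernel_ge0// lee_fin.
have /andP[x0 x1] := x01.
have y0 : 0 < 1 - x by rewrite subr_gt0.
have y01 : 0 < 1 - x < 1 by lra.
have := p1 _ _ a0 x01; have := p1 _ _ b0 y01.
rewrite (powR_predK a x0) (powR_predK b y0) /f /beta_kernel /beta_bump.
have := powR_ge0 x (a - 1); have := powR_ge0 (1 - x) (b - 1).
(* Here [p * q = (x * p) * q + ((1 - x) * q) * p <= q + p], because [x * p] and [(1 - x) * q] are at
   most 1. *)
move: (x `^ (a - 1)) (_ `^ (b - 1)) => p q; nra.
Qed.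

End beta_kernel.

(** * Logarithmic moments and differentiation in the first parameter *)

Section beta_mean.
Context {R : realType}.
Notation mu := (@lebesgue_measure R).
Implicit Types a b x m : R.

Lemma measurable_beta_kernelM (f : R -> R) a b (D : set R) :
  measurable_fun [set: R] f -> measurable_fun D (EFin \o (fun x => f x * beta_kernel a b x)).
Proof.
move=> mf; apply/measurable_EFinP; apply: measurable_funTS.
by apply: measurable_funM => //; exact: measurable_beta_kernel.
Qed.

Lemma ln_beta_kernel_le a b x : 0 < a -> 0 < x < 1 ->
  `|ln x| * beta_kernel a b x <= 2 / a * beta_kernel (a / 2) b x.
Proof.
move=> a0 x01; have /andP[x0 x1] := x01.
rewrite /beta_kernel /beta_bump !mulrA ler_wpM2r ?powR_ge0//.
have := ln_powR_le a0 x01.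
rewrite (powR_predK a x0) (powR_predK (a / 2) x0).
by rewrite [X in X <= _]mulrCA [X in _ <= X]mulrCA ler_pM2l.
Qed.

Lemma integrable_ln_beta_kernel a b : 0 < a -> 0 < b ->
  mu.-integrable `]0, 1[ (EFin \o (fun x => ln x * beta_kernel a b x)).
Proof.
move=> a0 b0; have a20 : 0 < a / 2 by rewrite divr_gt0.
have iw := integrable_beta_kernel a20 b0.
apply: (le_integrable _ _ _ (integrableZl _ (2 / a) iw)) => //.
  by apply: measurable_beta_kernelM; exact: measurable_ln.
move=> x; rewrite /= in_itv/= => x01; rewrite lee_fin normrM.
rewrite (ger0_norm (beta_kernel_ge0 _ _ _)).
by rewrite [leRHS]ger0_norm ?ln_beta_kernel_le// mulr_ge0 ?beta_kernel_ge0// divr_ge0// ltW.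
Qed.

(** On (0,1) the function [1 - ln x] dominates both constants and [|ln x|], so this one test covers
    every factor integrated against the kernel below. *)
Lemma integrable_log_growth_beta_kernel (f : R -> R) (C : R) a b :
  0 < a -> 0 < b -> measurable_fun [set: R] f ->
  (forall x, 0 < x < 1 -> `|f x| <= C * (1 - ln x)) ->
  mu.-integrable `]0, 1[ (EFin \o (fun x => f x * beta_kernel a b x)).
Proof.
move=> a0 b0 mf fC.
have ig : mu.-integrable `]0, 1[ (fun x =>
    C%:E * ((beta_kernel a b x)%:E - (ln x * beta_kernel a b x)%:E))%E.
  apply: integrableZl => //; apply: integrableB => //.
    exact: integrable_beta_kernel.
  exact: integrable_ln_beta_kernel.
apply: (le_integrable _ _ _ ig) => //.
  exact: measurable_beta_kernelM.
move=> x; rewrite /= in_itv/= => x01; rewrite lee_fin normrM.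
rewrite (ger0_norm (beta_kernel_ge0 _ _ _)).
apply: le_trans (ler_norm _); rewrite -[X in X - _]mul1r -mulrBl (mulrA C).
by rewrite ler_wpM2r ?beta_kernel_ge0 ?fC.
Qed.

Lemma is_derive_powRr (x t : R) : 0 < x ->
  is_derive t 1 (fun s : R => x `^ s) (ln x * x `^ t).
Proof.
move=> x0.
have d1 : is_derive t 1 (fun s : R => s * ln x) (ln x).
  have := is_deriveM (is_derive_id t 1) (is_derive_cst (ln x) t (1:R)).
  by move=> H; apply: (is_derive_eq H); rewrite /GRing.scale/=; ring.
have := @is_derive1_comp R expR (fun s => s * ln x) t _ _ (is_derive_expR _) d1.
have -> : expR \o (fun s => s * ln x) = (fun s => x `^ s).
  by apply/funext => s; rewrite /powR gt_eqF.
by move=> H; apply: (is_derive_eq H); rewrite /powR gt_eqF// mulrC.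
Qed.

Lemma is_derive_beta_kernel_param a b x : 0 < x ->
  is_derive a 1 (fun t => beta_kernel t b x) (ln x * beta_kernel a b x).
Proof.
move=> x0.
have d1 : is_derive a 1 (fun t : R => t - 1) 1.
  have := is_deriveB (is_derive_id a 1) (is_derive_cst (1:R) a (1:R)).
  by move=> H; apply: (is_derive_eq H); rewrite subr0.
have d2 := @is_derive1_comp R (fun s => x `^ s) (fun t => t - 1) a _ _ (is_derive_powRr (a - 1) x0) d1.
have := is_deriveM d2 (is_derive_cst ((1 - x) `^ (b - 1)) a (1:R)).
move=> H; apply: (is_derive_eq H).
rewrite /GRing.scale/= /beta_kernel /beta_bump; ring.
Qed.

(** Differentiation under the integral. For [t > a / 2] and [x] in (0,1),
    [x ^ (t - 1) <= x ^ (a / 2 - 1)], so the parameter derivatives near [a] are dominated by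
    [|ln x|] times the kernel at [a / 2], which is integrable. *)
Lemma is_derive_int_beta_kernel (D : set (measurableTypeR R)) a b : measurable D ->
  D `<=` `]0, 1[ -> 0 < a -> 0 < b ->
  is_derive a 1 (fun t => \int[mu]_(x in D) beta_kernel t b x)
    (\int[mu]_(x in D) (ln x * beta_kernel a b x)).
Proof.
move=> mD D01 a0 b0.
have a20 : 0 < a / 2 by rewrite divr_gt0.
have Ia : `]a / 2, a + 1[%classic a by rewrite /= in_itv/=; lra.
have intD t : `]a / 2, a + 1[%classic t -> mu.-integrable D (EFin \o beta_kernel t b).
  rewrite /= in_itv/= => /andP[ta _].
  apply: integrableS (integrable_beta_kernel _ b0) => //.
  exact: lt_trans ta.
have dD (t x : R) : D x -> is_derive t 1 (fun t => beta_kernel t b x) (ln x * beta_kernel t b x).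
  by move=> /D01; rewrite /= in_itv/= => /andP[x0 _]; exact: is_derive_beta_kernel_param.
have derD (t x : R) : `]a / 2, a + 1[%classic t -> D x -> derivable (fun t => beta_kernel t b x) t 1.
  by move=> _ Dx; exact: (@ex_derive _ _ _ _ _ _ _ (dD t x Dx)).
have d1E t x : D x -> partial1of2 (fun t => beta_kernel t b) t x = ln x * beta_kernel t b x.
  by move=> Dx; rewrite partial1of2E; exact: (@derive_val _ _ _ _ _ _ _ (dD t x Dx)).
pose G x := `|ln x * beta_kernel (a / 2) b x|.
have G0 x : 0 <= G x by exact: normr_ge0.
have intG : mu.-integrable D (EFin \o G).
  apply: (@integrableS _ _ _ mu `]0, 1[) => //.
  have := integrable_norm (integrable_ln_beta_kernel a20 b0).
  by apply.
have ubG t x : `]a / 2, a + 1[%classic t -> D x ->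
    `|partial1of2 (fun t => beta_kernel t b) t x| <= G x.
  rewrite /= in_itv/= => /andP[ta _] Dx; rewrite d1E// /G !(normrM (ln x)).
  apply: ler_wpM2l; first exact: normr_ge0.
  rewrite (ger0_norm (beta_kernel_ge0 t b x)) (ger0_norm (beta_kernel_ge0 (a / 2) b x)).
  rewrite /beta_kernel /beta_bump ler_wpM2r ?powR_ge0//.
  have /andP[x0 x1] : 0 < x < 1 by have := D01 _ Dx; rewrite /= in_itv.
  by apply: ger_powR; [rewrite x0 ltW|rewrite lerB// ltW].
have der := derivable_under_integral mD Ia intD derD G0 intG ubG.
have val := differentiation_under_integral mD Ia intD derD G0 intG ubG.
have -> : \int[mu]_(x in D) (ln x * beta_kernel a b x) =
    \int[mu]_(x in D) partial1of2 (fun t => beta_kernel t b) a x.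
  by apply: eq_Rintegral => x; rewrite inE => Dx; rewrite d1E.
by rewrite -val derive1E; apply/derivableP; exact: der.
Qed.

Lemma ln_ge_onemV (y : R) : 0 < y -> 1 - y^-1 <= ln y.
Proof.
move=> y0; have yV0 : 0 < y^-1 by rewrite invr_gt0.
have : ln (1 + (y^-1 - 1)) <= y^-1 - 1 by apply: le_ln1Dx; lra.
by rewrite addrC subrK lnV ?posrE//; lra.
Qed.

(** The function compares the trapezoid rule for exp on [0, ln y] with its integral [y - 1]. Its
    derivative [(ln y - (1 - 1/y)) / 2] is nonnegative and it vanishes at 1, so it has the sign of
    [y - 1]; this encodes both bounds of [ln y] by [2 (y - 1) / (y + 1)]. *)
Lemma ln_trapezoid (y z : R) : 0 < y -> y <= z ->
  (y + 1) / 2 * ln y - (y - 1) <= (z + 1) / 2 * ln z - (z - 1).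
Proof.
move=> y0 yz.
have d1 x : 0 < x -> is_derive x 1 (fun y : R => (y + 1) / 2 * ln y - (y - 1))
    ((ln x - (1 - x^-1)) / 2).
  move=> x0.
  have dl := is_derive1_ln x0.
  have d2 : is_derive x 1 (fun y : R => (y + 1) / 2) 2^-1.
    have := is_deriveM (is_deriveD (is_derive_id x 1) (is_derive_cst (1:R) x (1:R)))
      (is_derive_cst (2^-1:R) x (1:R)).
    by move=> H; apply: (is_derive_eq H); rewrite /GRing.scale/=; ring.
  have d3 : is_derive x 1 (fun y : R => y - 1) 1.
    have := is_deriveB (is_derive_id x 1) (is_derive_cst (1:R) x (1:R)).
    by move=> H; apply: (is_derive_eq H); rewrite subr0.
  have := is_deriveB (is_deriveM d2 dl) d3.
  move=> H; apply: (is_derive_eq H); rewrite /GRing.scale/=; field.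
  by rewrite gt_eqF.
have dH x : x \in `]y, z[ -> is_derive x 1 (fun y : R => (y + 1) / 2 * ln y - (y - 1))
    ((fun x => (ln x - (1 - x^-1)) / 2) x).
  by rewrite in_itv/= => /andP[yx _]; apply: d1; exact: lt_trans yx.
have cH : {within `[y, z], continuous (fun y : R => (y + 1) / 2 * ln y - (y - 1))}.
  apply: derivable_within_continuous => x; rewrite in_itv/= => /andP[yx _].
  exact: (@ex_derive _ _ _ _ _ _ _ (d1 x (lt_le_trans y0 yx))).
have [x xyz E] := @MVT_segment R _ _ _ _ yz dH cH.
rewrite -subr_ge0 E mulr_ge0 ?subr_ge0// divr_ge0// subr_ge0 ln_ge_onemV//.
by move: xyz; rewrite in_itv/= => /andP[yx _]; exact: lt_le_trans yx.
Qed.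

End beta_mean.

(** * Comparison of the two sides of the mean *)

Section beta_mean_inequality.
Context {R : realType}.
Notation mu := (@lebesgue_measure R).
Implicit Types x : R.
Variables a b : R.
Hypotheses (a0 : 0 < a) (b0 : 0 < b).
Let m := a / (a + b).
Let w := beta_kernel a b.

Let ab0 : 0 < a + b. Proof. exact: addr_gt0. Qed.

Let m01 : 0 < m < 1.
Proof. by rewrite divr_gt0//= ltr_pdivrMr// mul1r ltrDl. Qed.

Let wintegrable (f : R -> R) := mu.-integrable `]0, 1[ (EFin \o (fun x => f x * w x)).

Let wintegrable_lin c d (f g : R -> R) : wintegrable f -> wintegrable g -> wintegrable (fun x => c * f x + d * g x).
Proof.
move=> gf gg.
have : mu.-integrable `]0, 1[ (fun x => c%:E * (f x * w x)%:E + d%:E * (g x * w x)%:E)%E.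
  by apply: integrableD => //; apply: integrableZl.
apply: eq_integrable => // x _; rewrite /= -!EFinM -EFinD; congr EFin; ring.
Qed.

Let Rintegral_lin (A : set (measurableTypeR R)) c d (f g : R -> R) :
  measurable A -> A `<=` `]0, 1[ -> wintegrable f -> wintegrable g ->
  \int[mu]_(x in A) ((c * f x + d * g x) * w x) =
  c * \int[mu]_(x in A) (f x * w x) + d * \int[mu]_(x in A) (g x * w x).
Proof.
move=> mA A01 gf gg.
have gA h : wintegrable h -> mu.-integrable A (EFin \o (fun x => h x * w x)).
  by move=> gh; apply: integrableS gh.
have gAc e h : wintegrable h -> mu.-integrable A (EFin \o (fun x => e * (h x * w x))).
  by move=> gh; apply: (@integrableZl _ _ _ mu _ mA e) (gA _ gh).
rewrite -(RintegralZl c mA (gA _ gf)) -(RintegralZl d mA (gA _ gg)).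
rewrite -(RintegralD mA (gAc c _ gf) (gAc d _ gg)).
by apply: eq_Rintegral => x _; ring.
Qed.

Let wintegrable1 : wintegrable (fun=> 1).
Proof.
by apply: eq_integrable (integrable_beta_kernel a0 b0) => // x _; rewrite /= mul1r.
Qed.

Let split_at_mean (f : R -> R) : wintegrable f ->
  \int[mu]_(x in `]0, 1[) (f x * w x) =
  \int[mu]_(x in `]0, m[) (f x * w x) + \int[mu]_(x in `]m, 1[) (f x * w x).
Proof.
move=> gf; have /andP[m0 m1] := m01.
have gm : mu.-integrable `]0, m[ (EFin \o (fun x => f x * w x)).
  by apply: integrableS gf => //; apply: subset_itvl; rewrite bnd_simp ltW.
rewrite [X in _ = X + _](Rintegral_itv_bndo_bndc gm).
rewrite -(@Rintegral_itvB _ _ (BRight 0) (BLeft 1) m gf) ?bnd_simp ?ltW//.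
by rewrite subrKC.
Qed.

(** Factors of the weight [w]: on (0,1), [fW * w] is the derivative of [beta_bump a b] and [fV * w]
    that of [V] below; [fh] is the function h of the overview, with [ln (x / m)] written as a
    difference. *)
Let fW x := a - (a + b) * x.
Let fV x := fW x * (ln x - ln m) + (1 - x).
Let fh x := x / m - 1 - (ln x - ln m).

Let wintegrable_fW : wintegrable fW.
Proof.
apply: (@integrable_log_growth_beta_kernel _ _ (2 * (a + b))) => //.
  by apply: measurable_funB => //; apply: measurable_funM.
move=> x x01; have lx : ln x < 0 by rewrite ln_lt0.
have /andP[x0 x1] := x01.
have p1 : 0 < (a + b) * x by exact: mulr_gt0.
have p2 : (a + b) * x < a + b by rewrite gtr_pMr.
have p3 : (a + b) * ln x < 0 by rewrite pmulr_rlt0.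
have a_gt0 := a0; have b_gt0 := b0; rewrite ler_norml /fW; lra.
Qed.

Let wintegrable_fh : wintegrable fh.
Proof.
apply: (@integrable_log_growth_beta_kernel _ _ (1 + m^-1 + `|ln m|)) => //.
  apply: measurable_funB; first by apply: measurable_funB => //; apply: measurable_funM.
  by apply: measurable_funB => //; exact: measurable_ln.
move=> x x01; have lx : ln x < 0 by rewrite ln_lt0.
have im : 0 < m^-1 by rewrite invr_gt0; case/andP: m01.
have := ler_norm (ln m); have := lerNnormlW (lexx `|ln m|).
rewrite ler_norml /fh; move: (m^-1) (ln m) `|ln m| (ln x) im lx => im lm n l im0 l0; nra.
Qed.

Let wintegrable_fV : wintegrable fV.
Proof.
apply: (@integrable_log_growth_beta_kernel _ _ (2 * (a + b) * (1 + `|ln m|) + 1)) => //.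
  apply: measurable_funD; last exact: measurable_funB.
  apply: measurable_funM; first by apply: measurable_funB => //; apply: measurable_funM.
  by apply: measurable_funB => //; exact: measurable_ln.
move=> x x01; have lx : ln x < 0 by rewrite ln_lt0.
apply: le_trans (ler_normD _ _) _; rewrite normrM.
have h1 : `|fW x| <= 2 * (a + b).
  have /andP[x0 x1] := x01.
  have p1 : 0 < (a + b) * x by exact: mulr_gt0.
  have p2 : (a + b) * x < a + b by rewrite gtr_pMr.
  by have a_gt0 := a0; have b_gt0 := b0; rewrite ler_norml /fW; lra.
have h2 : `|ln x - ln m| <= (1 + `|ln m|) * (1 - ln x).
  apply: le_trans (ler_normB _ _) _; rewrite ltr0_norm//.
  by have := normr_ge0 (ln m); nra.
have h3 : `|1 - x| <= 1 - ln x by rewrite ger0_norm; lra.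
have := ler_pM (normr_ge0 _) (normr_ge0 _) h1 h2.
by lra.
Qed.

(** Stein's identity integrated up to the mean. Read backwards, it turns the boundary term of the
    derivative of U into an integral over (0,m). *)
Let int_fW_mean : \int[mu]_(x in `]0, m[) (fW x * w x) = beta_bump a b m.
Proof.
have /andP[m0 m1] := m01.
have sub x : x \in `]0, m[ -> 0 < x < 1.
  by rewrite in_itv/= => /andP[-> /lt_trans]; apply.
rewrite -[RHS]subr0; apply: Rintegral_FTC_oo => //.
- by apply: integrableS wintegrable_fW => //; apply: subset_itvl; rewrite bnd_simp ltW.
- move=> x /sub x01; apply: cvgM.
    by apply: cvgB; [exact: cvg_cst|apply: cvgM; [exact: cvg_cst|exact: cvg_id]].
  by apply: continuous_beta_bump; rewrite in_itv.
- by move=> x /sub x01; exact: is_derive_beta_bump.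
- exact: beta_bump_cvg0.
- by apply: cvg_at_left_filter; apply: continuous_beta_bump; rewrite in_itv.
Qed.

(** Both boundary values vanish; this is what identifies [m] as the mean. *)
Let int_fW : \int[mu]_(x in `]0, 1[) (fW x * w x) = 0.
Proof.
rewrite -[RHS](subr0 0); apply: Rintegral_FTC_oo => //.
- move=> x x01; apply: cvgM.
    by apply: cvgB; [exact: cvg_cst|apply: cvgM; [exact: cvg_cst|exact: cvg_id]].
  exact: continuous_beta_bump.
- by move=> x; rewrite in_itv/= => x01; exact: is_derive_beta_bump.
- exact: beta_bump_cvg0.
- exact: beta_bump_cvg1.
Qed.

(* [V] vanishes at [0], [m] and [1], so its derivative [fV * w] integrates to 0
   on both sides of [m]. *)
Let V x := beta_bump a b x * (ln x - ln m).

Let is_derive_V x : 0 < x < 1 -> is_derive x 1 V (fV x * w x).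
Proof.
move=> x01; have /andP[x0 x1] := x01.
have dl := is_deriveB (is_derive1_ln x0) (is_derive_cst (ln m) x (1:R)).
have := is_deriveM (is_derive_beta_bump a b x01) dl.
move=> H; apply: (is_derive_eq H); rewrite /GRing.scale/= /fV /w subr0.
have -> : beta_bump a b x = x * (1 - x) * beta_kernel a b x.
  have y0 : 0 < 1 - x by rewrite subr_gt0.
  rewrite /beta_kernel /beta_bump (powR_predK a x0) (powR_predK b y0); ring.
by rewrite /fW !fctE; field; rewrite gt_eqF.
Qed.

Let continuous_fV x : 0 < x < 1 -> {for x, continuous (fun x => fV x * w x)}.
Proof.
move=> x01; have /andP[x0 x1] := x01; apply: cvgM.
  apply: cvgD; last by apply: cvgB; [exact: cvg_cst|exact: cvg_id].
  apply: cvgM.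
    by apply: cvgB; [exact: cvg_cst|apply: cvgM; [exact: cvg_cst|exact: cvg_id]].
  by apply: cvgB; [exact: continuous_ln|exact: cvg_cst].
by apply: continuous_beta_bump; rewrite in_itv.
Qed.

Let continuous_V : {for m, continuous V}.
Proof.
apply/differentiable_continuous/derivable1_diffP.
exact: (@ex_derive _ _ _ _ _ _ _ (is_derive_V m01)).
Qed.

Let Vm : V m = 0. Proof. by rewrite /V subrr mulr0. Qed.

Let int_fV_left : \int[mu]_(x in `]0, m[) (fV x * w x) = 0.
Proof.
have /andP[m0 m1] := m01.
have sub x : x \in `]0, m[ -> 0 < x < 1.
  by rewrite in_itv/= => /andP[-> /lt_trans]; apply.
rewrite -[RHS](subr0 0) -[X in _ = X - _]Vm; apply: (@Rintegral_FTC_oo _ _ V) => //.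
- by apply: integrableS wintegrable_fV => //; apply: subset_itvl; rewrite bnd_simp ltW.
- by move=> x /sub x01; exact: continuous_fV.
- by move=> x /sub x01; exact: is_derive_V.
- exact: beta_bump_ln_cvg0.
- by apply: cvg_at_left_filter; exact: continuous_V.
Qed.

Let int_fV_right : \int[mu]_(x in `]m, 1[) (fV x * w x) = 0.
Proof.
have /andP[m0 m1] := m01.
have sub x : x \in `]m, 1[ -> 0 < x < 1.
  by rewrite in_itv/= => /andP[/(lt_trans m0)-> ->].
rewrite -[RHS](subr0 0) -[X in _ = _ - X]Vm; apply: (@Rintegral_FTC_oo _ _ V) => //.
- by apply: integrableS wintegrable_fV => //; apply: subset_itvr; rewrite bnd_simp ltW.
- by move=> x /sub x01; exact: continuous_fV.
- by move=> x /sub x01; exact: is_derive_V.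
- by apply: cvg_at_right_filter; exact: continuous_V.
- exact: beta_bump_ln_cvg1.
Qed.

(** As [fV m = 1 - m], this constant makes [kappa - fV / (2 * a)] vanish at [m], where [fh] vanishes
    too. *)
Let kappa := (1 - m) / (2 * a).

(* Both summands on the right-hand side have the sign of [x - m]. *)
Let fh_fV_gap x : 0 < x ->
  kappa * 1 + (- (2 * a)^-1) * fV x - fh x =
  (x - m) / (2 * a) + ((x / m + 1) / 2 * ln (x / m) - (x / m - 1)).
Proof.
move=> x0; have /andP[m0 m1] := m01.
rewrite ln_div ?posrE// /kappa /fV /fh /fW.
(* Eliminating [b] in favour of [m] leaves a rational identity in [a], [m], [x] and the two
   logarithms. *)
have bE : b = a / m - a.
  by rewrite /m; field; rewrite !gt_eqF.
rewrite bE; clear bE; field.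
by rewrite !gt_eqF.
Qed.

Let left_bound x : 0 < x -> x <= m ->
  (kappa * 1 + (- (2 * a)^-1) * fV x) * w x <= fh x * w x.
Proof.
move=> x0 xm; have /andP[m0 m1] := m01.
rewrite ler_wpM2r ?beta_kernel_ge0// -subr_le0 fh_fV_gap//.
have xm1 : x / m <= 1 by rewrite ler_pdivrMr// mul1r.
have := @ln_trapezoid R _ _ (divr_gt0 x0 m0) xm1.
rewrite ln1 mulr0 subrr subr0 => H.
have h : (x - m) / (2 * a) <= 0.
  by rewrite mulr_le0_ge0 ?subr_le0// invr_ge0 mulr_ge0// ltW.
by rewrite -(addr0 0) lerD.
Qed.

Let right_bound x : m <= x ->
  fh x * w x <= (kappa * 1 + (- (2 * a)^-1) * fV x) * w x.
Proof.
move=> mx; have /andP[m0 m1] := m01; have x0 := lt_le_trans m0 mx.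
rewrite ler_wpM2r ?beta_kernel_ge0// -subr_ge0 fh_fV_gap//.
have xm1 : 1 <= x / m by rewrite ler_pdivlMr// mul1r.
have := @ln_trapezoid R _ _ ltr01 xm1.
rewrite ln1 mulr0 subrr subr0 => H.
by rewrite addr_ge0// divr_ge0 ?subr_ge0// mulr_ge0// ltW.
Qed.

(** In the overview's notation this is U' B <= U B'. After [ln x] is expanded through [fh] and [fW],
    the [ln m] terms cancel, and the [fW] integral over (0,m) cancels the boundary term. What
    remains is u hn <= n hu, where u, n are the masses left and right of [m] and hu, hn the
    integrals of [fh * w] there; [kappa] separates hu/u from hn/n. *)
Lemma beta_mean_inequality :
  (\int[mu]_(x in `]0, m[) (ln x * beta_kernel a b x) + beta_bump a b m / a) *
    \int[mu]_(x in `]0, 1[) beta_kernel a b x <=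
  \int[mu]_(x in `]0, m[) beta_kernel a b x *
    \int[mu]_(x in `]0, 1[) (ln x * beta_kernel a b x).
Proof.
have /andP[m0 m1] := m01.
have s0 : `]0, m[ `<=` `]0, 1[ by apply: subset_itvl; rewrite bnd_simp ltW.
have s1 : `]m, 1[ `<=` `]0, 1[ by apply: subset_itvr; rewrite bnd_simp ltW.
have gl : wintegrable (fun x => kappa * 1 + (- (2 * a)^-1) * fV x) by exact: wintegrable_lin.
(* The [fV] term integrates to 0 on each side of [m], so the pointwise bounds leave [kappa] times
   the mass, below on the left and above on the right. *)
have HU : kappa * \int[mu]_(x in `]0, m[) (1 * w x) <= \int[mu]_(x in `]0, m[) (fh x * w x).
  rewrite -[leLHS]addr0 -[X in _ + X <= _](mulr0 (- (2 * a)^-1)) -[X in _ + _ * X <= _]int_fV_left.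
  rewrite -Rintegral_lin//; apply: le_Rintegral => //.
  - exact: integrableS gl.
  - exact: integrableS wintegrable_fh.
  - by move=> x; rewrite /= in_itv/= => /andP[x0 xm]; apply: left_bound => //; exact: ltW.
have HN : \int[mu]_(x in `]m, 1[) (fh x * w x) <= kappa * \int[mu]_(x in `]m, 1[) (1 * w x).
  rewrite -[leRHS]addr0 -[X in _ <= _ + X](mulr0 (- (2 * a)^-1)) -[X in _ <= _ + _ * X]int_fV_right.
  rewrite -Rintegral_lin//; apply: le_Rintegral => //.
  - exact: integrableS wintegrable_fh.
  - exact: integrableS gl.
  - by move=> x; rewrite /= in_itv/= => /andP[mx x1]; apply: right_bound; exact: ltW.
(* Pointwise [ln x = ln m - fh x - fW x / a], since [fW x = a * (1 - x / m)]. *)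
have lnE (A : set (measurableTypeR R)) : measurable A -> A `<=` `]0, 1[ ->
    \int[mu]_(x in A) (ln x * w x) = ln m * \int[mu]_(x in A) (1 * w x) -
      \int[mu]_(x in A) (fh x * w x) - \int[mu]_(x in A) (fW x * w x) / a.
  move=> mA sA.
  transitivity (\int[mu]_(x in A) ((1 * (ln m * 1 + (- 1) * fh x) + (- a^-1) * fW x) * w x)).
    apply: eq_Rintegral => x _; congr (_ * _).
    have -> : fW x = a * (1 - x / m) by rewrite /fW /m; field; rewrite !gt_eqF.
    by rewrite /fh; field; rewrite !gt_eqF.
  rewrite (Rintegral_lin 1 (- a^-1) (f := fun x => ln m * 1 + (- 1) * fh x))//; last first.
    exact: wintegrable_lin.
  by rewrite Rintegral_lin//; ring.
have w1 (A : set (measurableTypeR R)) : \int[mu]_(x in A) beta_kernel a b x = \int[mu]_(x in A) (1 * w x).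
  by apply: eq_Rintegral => x _; rewrite mul1r.
rewrite !w1 !lnE// int_fW int_fW_mean !split_at_mean//.
have U0 : 0 <= \int[mu]_(x in `]0, m[) (1 * w x).
  by apply: Rintegral_ge0 => x _; rewrite mul1r beta_kernel_ge0.
have N0 : 0 <= \int[mu]_(x in `]m, 1[) (1 * w x).
  by apply: Rintegral_ge0 => x _; rewrite mul1r beta_kernel_ge0.
(* Weighting the left bound by n and the right one by u makes [kappa * u * n] the common middle
   term. *)
move: (ler_wpM2r N0 HU) (ler_wpM2l U0 HN); rewrite mul0r subr0 subrK -subr_ge0 -(subr_ge0 (_ * _)).
move: (\int[mu]_(x in `]0, m[) (1 * w x)) (\int[mu]_(x in `]m, 1[) (1 * w x))
  (\int[mu]_(x in `]0, m[) (fh x * w x)) (\int[mu]_(x in `]m, 1[) (fh x * w x)) => u n hu hn le1 le2.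
rewrite -subr_ge0; apply: le_trans (addr_ge0 le1 le2) _; rewrite le_eqVlt; apply/orP; left; apply/eqP.
ring.
Qed.

(** Since [fW <= a] on (0,m), [a] times the mass of (0,m) is at least the integral of [fW * w]
    there, which is the positive number [beta_bump a b m]. *)
Lemma integral_beta_kernel_gt0 : 0 < \int[mu]_(x in `]0, 1[) beta_kernel a b x.
Proof.
have /andP[m0 m1] := m01.
have s0 : `]0, m[ `<=` `]0, 1[ by apply: subset_itvl; rewrite bnd_simp ltW.
have -> : \int[mu]_(x in `]0, 1[) beta_kernel a b x = \int[mu]_(x in `]0, 1[) (1 * w x).
  by apply: eq_Rintegral => x _; rewrite mul1r.
rewrite split_at_mean// ltr_wpDr//.
  by apply: Rintegral_ge0 => x _; rewrite mul1r beta_kernel_ge0.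
have E : a * \int[mu]_(x in `]0, m[) (1 * w x) =
    \int[mu]_(x in `]0, m[) ((a * 1 + 0 * 1) * w x).
  by rewrite Rintegral_lin// mul0r addr0.
rewrite -(pmulr_rgt0 _ a0) E.
apply: lt_le_trans (beta_bump_gt0 a b m01) _; rewrite -int_fW_mean.
apply: le_Rintegral => //.
- exact: integrableS wintegrable_fW.
- exact: integrableS (wintegrable_lin a 0 wintegrable1 wintegrable1).
- move=> x; rewrite /= in_itv/= => /andP[x0 _].
  by rewrite ler_wpM2r ?beta_kernel_ge0// /fW mulr1 mul0r addr0 gerBl mulr_ge0// ltW.
Qed.

(** Write [x = m - fW x / (a + b)]; the [fW] part integrates to 0. *)
Lemma integral_beta_kernel_mean :
  \int[mu]_(x in `]0, 1[) (x * beta_kernel a b x) =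
  m * \int[mu]_(x in `]0, 1[) beta_kernel a b x.
Proof.
have -> : \int[mu]_(x in `]0, 1[) beta_kernel a b x = \int[mu]_(x in `]0, 1[) (1 * w x).
  by apply: eq_Rintegral => x _; rewrite mul1r.
transitivity (\int[mu]_(x in `]0, 1[) ((m * 1 + (- (a + b)^-1) * fW x) * w x)).
  apply: eq_Rintegral => x _; congr (_ * _).
  by rewrite /fW /m; field; rewrite gt_eqF.
by rewrite Rintegral_lin// int_fW mulr0 addr0.
Qed.

End beta_mean_inequality.

(** * Monotonicity and reflection *)

Section beta_mean_monotone.
Context {R : realType}.
Notation mu := (@lebesgue_measure R).
Implicit Types a b x : R.

Lemma is_derive_beta_kernel_primitive a b x : 0 < a -> 0 < b -> 0 < x < 1 ->
  is_derive x 1 (fun y => \int[mu]_(z in `]0, y[) beta_kernel a b z) (beta_kernel a b x).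
Proof.
move=> a0 b0 x01; have /andP[x0 x1] := x01.
(* Any point strictly between [x] and 1 would do as an upper limit. The fundamental theorem applies
   to the primitive over []0, y]], which agrees with the one over []0, y[] for [y] near [x]. *)
pose u := (x + 1) / 2.
have xu : x < u by rewrite /u; lra.
have u1 : u < 1 by rewrite /u; lra.
have ik y : y < 1 -> mu.-integrable `]0, y] (EFin \o beta_kernel a b).
  move=> y1; apply: integrableS (integrable_beta_kernel a0 b0) => //.
  by apply: subset_itvl; rewrite bnd_simp.
have cx : {for x, continuous (beta_kernel a b)}.
  by apply: continuous_beta_bump; rewrite in_itv.
have [dx d1] := @continuous_FTC1 _ (beta_kernel a b) (BRight 0) x u xu (ik u u1) x0 cx.
have dG : is_derive x 1 (fun y => \int[mu]_(z in `]0, y]) beta_kernel a b z) (beta_kernel a b x).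
  by rewrite -d1 derive1E; apply/derivableP; exact: dx.
apply: (near_eq_is_derive _ dG); near=> y; rewrite -Rintegral_itv_bndo_bndc//.
apply: integrableS (ik y _) => //; first by apply: subset_itvl; rewrite bnd_simp.
by near: y; exact: lt_nbhsl.
Unshelve. all: by end_near. Qed.

(** Joint continuity in base and exponent, through [expR (q * ln p)]: near a positive limit the base
    is positive, away from the convention for powers of 0. It supplies the continuity hypothesis of
    [is_derive_diag]. *)
Lemma cvg_powR (T : Type) (F : set_system T) (FF : Filter F) (u v : T -> R) (p q : R) :
  0 < p -> u @ F --> p -> v @ F --> q -> u x `^ v x @[x --> F] --> p `^ q.
Proof.
move=> p0 up vq.
have H : expR (v x * ln (u x)) @[x --> F] --> expR (q * ln p).
  apply: continuous_cvg; first exact: continuous_expR.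
  apply: cvgM => //; apply: continuous_cvg => //; exact: continuous_ln.
rewrite /powR gt_eqF//; apply: cvg_trans H; apply: near_eq_cvg; near=> x.
rewrite gt_eqF//; near: x; exact: (cvgr_gt p).
Unshelve. all: by end_near. Qed.

Lemma is_derive_beta_mean a b : 0 < a -> 0 < b ->
  is_derive a 1 (fun t : R => t / (t + b)) (b / (a + b) ^+ 2).
Proof.
move=> a0 b0; have ab0 : a + b != 0 by rewrite gt_eqF// addr_gt0.
have d1 : is_derive a 1 (fun t : R => t + b) 1.
  have := is_deriveD (is_derive_id a 1) (is_derive_cst b a (1:R)).
  by move=> H; apply: (is_derive_eq H); rewrite addr0.
have := is_deriveM (is_derive_id a 1) (is_deriveV (f := fun t : R => t + b) ab0 d1).
by move=> H; apply: (is_derive_eq H); rewrite /GRing.scale/=; field.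
Qed.

Lemma beta_mean01 a b : 0 < a -> 0 < b -> 0 < a / (a + b) < 1.
Proof.
by move=> a0 b0; rewrite divr_gt0 ?addr_gt0//= ltr_pdivrMr ?addr_gt0// mul1r ltrDl.
Qed.

(** Leibniz rule with a moving endpoint. The endpoint term is w(m) m' with m' = b/(a+b)^2 =
    m(1-m)/a, hence [beta_bump a b m / a]. *)
Lemma is_derive_beta_below_mean a b : 0 < a -> 0 < b ->
  is_derive a 1 (fun t => \int[mu]_(x in `]0, t / (t + b)[) beta_kernel t b x)
    (\int[mu]_(x in `]0, a / (a + b)[) (ln x * beta_kernel a b x) +
     beta_bump a b (a / (a + b)) / a).
Proof.
move=> a0 b0; have m01 := beta_mean01 a0 b0; have /andP[m0 m1] := m01.
have s0 : `]0, (a / (a + b))[%classic `<=` `]0, 1[%classic.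
  by apply: subset_itvl; rewrite bnd_simp ltW.
have -> : beta_bump a b (a / (a + b)) / a =
    beta_kernel a b (a / (a + b)) * (b / (a + b) ^+ 2).
  have y0 : 0 < 1 - a / (a + b) by rewrite subr_gt0.
  rewrite /beta_kernel /beta_bump (powR_predK a m0) (powR_predK b y0).
  move: ((a / (a + b)) `^ (a - 1)) ((1 - a / (a + b)) `^ (b - 1)) => p q; field.
  by rewrite !gt_eqF// addr_gt0.
apply: (@is_derive_diag _ (fun t x => \int[mu]_(y in `]0, x[) beta_kernel t b y)
  (fun t x => beta_kernel t b x) (fun t => t / (t + b))).
- exact: is_derive_int_beta_kernel.
- near=> t => x; rewrite in_itv/= => /andP[ax xb].
  have t0 : 0 < t by near: t; exact: lt_nbhsr.
  have /andP[t0' t1] := beta_mean01 t0 b0.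
  apply: is_derive_beta_kernel_primitive => //; apply/andP; split.
    by apply: lt_le_trans ax; rewrite lt_min m0.
  by apply: le_lt_trans xb _; rewrite gt_max m1.
- move=> t_ x_ ta xm; apply: cvgM; apply: cvg_powR => //.
  + by apply: cvgB => //; exact: cvg_cst.
  + by rewrite subr_gt0.
  + by apply: cvgB => //; exact: cvg_cst.
  + exact: cvg_cst.
- exact: is_derive_beta_mean.
Unshelve. all: by end_near. Qed.

(** By the quotient rule, [beta_mean_inequality] says that the derivative in the first parameter is
    nonpositive; the mean value theorem concludes. *)
Lemma beta_below_mean_nonincreasing b a1 a2 : 0 < b -> 0 < a1 -> a1 <= a2 ->
  (\int[mu]_(x in `]0, a2 / (a2 + b)[) beta_kernel a2 b x) /
    (\int[mu]_(x in `]0, 1[) beta_kernel a2 b x) <=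
  (\int[mu]_(x in `]0, a1 / (a1 + b)[) beta_kernel a1 b x) /
    (\int[mu]_(x in `]0, 1[) beta_kernel a1 b x).
Proof.
move=> b0 a10 a12.
pose U t := \int[mu]_(x in `]0, t / (t + b)[) beta_kernel t b x.
pose B t := \int[mu]_(x in `]0, 1[) beta_kernel t b x.
pose dU t := \int[mu]_(x in `]0, t / (t + b)[) (ln x * beta_kernel t b x) +
  beta_bump t b (t / (t + b)) / t.
pose dB t := \int[mu]_(x in `]0, 1[) (ln x * beta_kernel t b x).
have B0 t : 0 < t -> 0 < B t by move=> t0; exact: integral_beta_kernel_gt0.
have dQ (t : R) : 0 < t ->
    is_derive t 1 (fun t => U t / B t) ((dU t * B t - U t * dB t) / B t ^+ 2).
  move=> t0; have Bt0 : B t != 0 by rewrite gt_eqF// B0.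
  have dBt : is_derive t 1 B (dB t) by exact: is_derive_int_beta_kernel.
  have := is_deriveM (is_derive_beta_below_mean t0 b0) (is_deriveV (f := B) Bt0 dBt).
  move=> H; apply: (is_derive_eq H); rewrite /GRing.scale/= -/(U t) -/(dU t).
  by field.
have dH t : t \in `]a1, a2[ -> is_derive t 1 (fun t => U t / B t)
    ((fun t => (dU t * B t - U t * dB t) / B t ^+ 2) t).
  by rewrite in_itv/= => /andP[ta _]; apply: dQ; exact: lt_trans ta.
have cH : {within `[a1, a2], continuous (fun t => U t / B t)}.
  apply: derivable_within_continuous => t; rewrite in_itv/= => /andP[ta _].
  exact: (@ex_derive _ _ _ _ _ _ _ (dQ t (lt_le_trans a10 ta))).
have [t ta E] := @MVT_segment R _ _ _ _ a12 dH cH.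
rewrite -subr_le0 -/(U a2) -/(U a1) -/(B a1) -/(B a2) E.
rewrite mulr_le0_ge0 ?subr_ge0// mulr_le0_ge0 ?invr_ge0 ?sqr_ge0// subr_le0.
apply: beta_mean_inequality => //.
by move: ta; rewrite in_itv/= => /andP[ta _]; exact: lt_le_trans ta.
Qed.

(** By uniqueness of Lebesgue measure it is enough to test the intervals []a, b]]; reflection turns
    them into [[1 - b, 1 - a[], of the same length. *)
Lemma lebesgue_measure_onem (A : set R) : measurable A ->
  pushforward mu ((fun x => 1 - x) : _ -> measurableTypeR R) A = mu A.
Proof.
have mo : measurable_fun [set: measurableTypeR R] ((fun x => 1 - x) : _ -> measurableTypeR R).
  exact: measurable_funB.
pose phi : {mfun _ >-> _} := HB.pack ((fun x => 1 - x) : measurableTypeR R -> measurableTypeR R)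
  (isMeasurableFun.Build _ _ _ _ _ mo).
move=> mA; apply/esym; apply: (@lebesgue_measure_unique _ (pushforward mu phi)) => //= _ [[a b]] _ <-.
rewrite /pushforward (_ : _ @^-1` _ = `[1 - b, 1 - a[%classic).
  rewrite !lebesgue_measure_itv/= !lte_fin ltrD2l ltrN2.
  by case: ifPn => // _; rewrite -!EFinD; congr EFin; ring.
by apply/seteqP; split => x /=; rewrite !in_itv/= => /andP[? ?]; apply/andP; split; lra.
Qed.

Lemma ge0_integral_onem (f : R -> \bar R) (D : set R) : measurable D ->
  measurable_fun [set: R] f -> (forall x, 0 <= f x)%E ->
  (\int[mu]_(x in D) f x = \int[mu]_(x in (fun x => (1 - x)%R) @^-1` D) f (1 - x)%R)%E.
Proof.
move=> mD mf f0.
have mo : measurable_fun [set: measurableTypeR R] ((fun x => 1 - x) : _ -> measurableTypeR R).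
  exact: measurable_funB.
transitivity (\int[pushforward mu ((fun x => 1 - x)%R : _ -> measurableTypeR R)]_(x in D) f x)%E.
  by apply: eq_measure_integral => //= A mA AS; exact/esym/lebesgue_measure_onem.
by rewrite ge0_integral_pushforward//; exact: measurable_funTS.
Qed.

Lemma integral_beta_kernel_onem a b (c d : R) :
  \int[mu]_(x in `]c, d[) beta_kernel a b x =
  \int[mu]_(x in `]1 - d, 1 - c[) beta_kernel b a x.
Proof.
have mf : measurable_fun [set: R] (EFin \o beta_kernel a b).
  by apply/measurable_EFinP; exact: measurable_beta_kernel.
have f0 x : (0 <= (EFin \o beta_kernel a b) x)%E by rewrite lee_fin beta_kernel_ge0.
have E := @ge0_integral_onem _ `]c, d[%classic (measurable_itv _) mf f0.
have pre : (fun x => 1 - x) @^-1` `]c, d[ = `]1 - d, 1 - c[%classic.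
  by apply/seteqP; split => x /=; rewrite !in_itv/= => /andP[? ?]; apply/andP; split; lra.
rewrite /Rintegral [X in fine X = _]E pre; congr fine.
by apply: eq_integral => x _; congr EFin; exact: beta_bump_sym.
Qed.

End beta_mean_monotone.

(** * Beta random variables *)

Section density.
Context {R : realType}.
Notation mu := (@lebesgue_measure R).

(** The law [nu] is absolutely continuous, and its Radon-Nikodym derivative equals [g] almost
    everywhere because both have the same integral over every measurable set. *)
Lemma ge0_integral_density (nu : probability (measurableTypeR R) R) (g : R -> R)
    (f : R -> \bar R) :
  measurable_fun [set: R] g -> (forall x, 0 <= g x) ->
  (forall A, measurable A -> nu A = \int[mu]_(x in A) (g x)%:E)%E ->
  measurable_fun [set: R] f -> (forall x, 0 <= f x)%E ->
  (\int[nu]_x f x = \int[mu]_x (f x * (g x)%:E))%E.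
Proof.
move=> mg g0 nuE mf f0.
have dom : nu `<< mu.
  apply/null_content_dominatesP => A mA muA0; rewrite nuE//.
  by apply: null_set_integral => //; apply/measurable_EFinP; exact: measurable_funTS.
rewrite -(Radon_Nikodym_SigmaFinite.change_of_variables dom f0 measurableT mf).
have ig : mu.-integrable [set: R] (EFin \o g).
  apply/integrableP; split; first exact/measurable_EFinP.
  under eq_integral do rewrite /= ger0_norm//.
  by rewrite -nuE// probability_setT ltry.
have irn := Radon_Nikodym_SigmaFinite.f_integrable dom.
apply: ae_eq_integral => //.
- by apply: emeasurable_funM => //; exact: measurable_int irn.
- by apply: emeasurable_funM => //; exact/measurable_EFinP.
- apply: ae_eqe_mul2l.
  apply: integral_ae_eq => //.
  + by apply/measurable_EFinP.
  + by move=> A _ mA; rewrite -Radon_Nikodym_SigmaFinite.f_integral//; exact: nuE.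
Qed.

(** As [g] vanishes on the negative reals, the negative part of [X] contributes 0 and the
    expectation reduces to a nonnegative integral. *)
Lemma expectation_density d (T : measurableType d) (P : probability T R)
    (X : {RV P >-> R}) (g : R -> R) :
  measurable_fun [set: R] g -> (forall x, 0 <= g x) -> (forall x, x < 0 -> g x = 0) ->
  (forall A, measurable A -> distribution P X A = \int[mu]_(x in A) (g x)%:E)%E ->
  ('E_P[X] = \int[mu]_x (x * g x)%:E)%E.
Proof.
move=> mg g0 gN XE.
have mid : measurable_fun [set: R] (EFin : R -> \bar R) by exact/measurable_EFinP.
(* [X] is retyped with codomain [measurableTypeR R], the space that carries [mu], so that its law
   can be compared with [mu]. *)
have mX : measurable_fun [set: T] (X : T -> measurableTypeR R).
  have mX : measurable_fun [set: T] (X : T -> R) by exact: measurable_funPT.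
  by move=> _ B mB; exact: (mX measurableT B mB).
pose X' : {RV P >-> measurableTypeR R} := HB.pack (X : T -> measurableTypeR R)
  (isMeasurableFun.Build _ _ _ _ _ mX).
have int f : measurable_fun [set: R] f -> (forall x, 0 <= f x)%E ->
    (\int[P]_x (f \o X) x = \int[mu]_x (f x * (g x)%:E))%E.
  move=> mf f0; rewrite -(@ge0_integral_distribution _ _ _ _ _ P X')//.
  exact: ge0_integral_density.
rewrite unlock integralE.
rewrite (_ : (fun w => (X w)%:E) = EFin \o X)// funepos_comp funeneg_comp.
rewrite !int//; [|exact: measurable_funeneg|exact: measurable_funepos].
rewrite [X in (_ - X)%E]integral0_eq ?sube0; last first.
  move=> x _; have [x0|x0] := leP 0 x; last by rewrite gN// mule0.
  by rewrite funenegE -EFinN max_r ?mul0e// lee_fin oppr_le0.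
apply: eq_integral => x _; have [x0|x0] := leP 0 x; last by rewrite gN// mule0 mulr0.
by rewrite funeposE max_l ?lee_fin.
Qed.

End density.

(** * Mean and upper tail of a Beta variable *)

Section beta_distribution.
Context {R : realType}.
Notation mu := (@lebesgue_measure R).

Lemma Beta_gt0 (a b : R) : 0 < a -> 0 < b -> 0 < Beta a b.
Proof. exact: integral_beta_kernel_gt0. Qed.

Lemma Beta_pdfE (a b : R) : Beta_pdf a b = (fun x => beta_kernel a b x / Beta a b) \_ `]0, 1[.
Proof. by []. Qed.

(** The factor [h] is the identity for the mean and the constant 1 for the tail. *)
Lemma integral_Beta_pdf (A : set R) (h : R -> R) (a b : R) : measurable A ->
  (\int[mu]_(x in A) (h x * Beta_pdf a b x)%:E =
   \int[mu]_(x in A `&` `]0%R, 1%R[) (h x * (beta_kernel a b x / Beta a b))%:E)%E.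
Proof.
move=> mA; rewrite integral_mkcondr; apply: eq_integral => x _.
by rewrite Beta_pdfE !patchE; case: ifP; rewrite ?mulr0.
Qed.

Lemma expectation_Beta d (T : measurableType d) (P : probability T R)
    (X : {RV P >-> R}) (a b : R) : 0 < a -> 0 < b -> Beta_distributed X a b ->
  ('E_P[X] = (a / (a + b))%R%:E)%E.
Proof.
move=> a0 b0 XE; have B0 := Beta_gt0 a0 b0.
have mw : measurable_fun [set: R] (fun x => beta_kernel a b x / Beta a b).
  by apply: measurable_funM => //; exact: measurable_beta_kernel.
rewrite (expectation_density _ _ _ XE); last 3 first.
- exact: (@measurable_restrictT _ _ R R `]0, 1[%classic _ (measurable_itv _)).1 (measurable_funTS mw).
- by move=> x; rewrite Beta_pdfE patchE; case: ifP => // _; rewrite divr_ge0 ?beta_kernel_ge0 ?ltW.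
- move=> x x0; rewrite Beta_pdfE patchE; case: ifP => //.
  by rewrite inE/= in_itv/= ltNge ltW.
rewrite (integral_Beta_pdf (fun x => x))// setTI.
have ix : mu.-integrable `]0, 1[ (EFin \o (fun x => x * beta_kernel a b x)).
  apply: (@integrable_log_growth_beta_kernel _ _ 1) => // x x01.
  by rewrite mul1r ger0_norm; have := @ln_lt0 R x; lra.
transitivity ((\int[mu]_(x in `]0, 1[) (x * beta_kernel a b x * (Beta a b)^-1))%:E).
  rewrite /Rintegral fineK; last first.
    by apply: integrable_fin_num => //; exact: (@integrableZr _ _ _ mu _ _ (Beta a b)^-1 _ ix).
  by apply: eq_integral => x _; rewrite mulrA.
rewrite RintegralZr// integral_beta_kernel_mean// -/(Beta a b) mulfK// gt_eqF//.
Qed.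

(** The event is the preimage of [[m, +oo[]; the support of the density cuts this to [[m, 1[], and
    the endpoint [m] is null. *)
Lemma prob_ge_mean_Beta d (T : measurableType d) (P : probability T R)
    (X : {RV P >-> R}) (a b : R) : 0 < a -> 0 < b -> Beta_distributed X a b ->
  prob_ge_mean X =
  ((\int[mu]_(x in `](a / (a + b)), 1[) beta_kernel a b x) / Beta a b)%:E.
Proof.
move=> a0 b0 XE; have /andP[m0 m1] := beta_mean01 a0 b0.
rewrite /prob_ge_mean (expectation_Beta a0 b0 XE).
rewrite (_ : [set w | _] = X @^-1` `[a / (a + b), +oo[); last first.
  by apply/seteqP; split => w /=; rewrite in_itv/= andbT lee_fin.
have -> : P (X @^-1` `[a / (a + b), +oo[) = distribution P X `[a / (a + b), +oo[ by [].
rewrite XE//.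
have := @integral_Beta_pdf `[a / (a + b), +oo[ (fun=> 1) a b (measurable_itv _).
under eq_integral do rewrite mul1r; move=> ->.
rewrite (_ : _ `&` _ = `[a / (a + b), 1[%classic); last first.
  apply/seteqP; split => x /=; rewrite !in_itv/= ?andbT.
    by move=> [-> /andP[_ ->]].
  by move=> /andP[mx ->]; rewrite mx (lt_le_trans m0 mx).
have iw : mu.-integrable `]a / (a + b), 1[ (EFin \o beta_kernel a b).
  apply: integrableS (integrable_beta_kernel a0 b0) => //.
  by apply: subset_itvr; rewrite bnd_simp ltW.
have iw' := integrable_itv_bndoo true true iw.
rewrite -RintegralZr// (Rintegral_itv_obnd_cbnd (f := fun x => beta_kernel a b x / Beta a b)).
  rewrite /Rintegral fineK.
    by apply: eq_integral => x _; rewrite mul1r.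
  by apply: integrable_fin_num => //; exact: (@integrableZr _ _ _ mu _ _ (Beta a b)^-1 _ iw').
exact: (@integrableZr _ _ _ mu _ _ (Beta a b)^-1 _ iw).
Qed.

Lemma beta_kernel_split_mean (a b : R) : 0 < a -> 0 < b ->
  Beta a b = \int[mu]_(x in `]0, (a / (a + b))[) beta_kernel a b x +
    \int[mu]_(x in `](a / (a + b)), 1[) beta_kernel a b x.
Proof.
move=> a0 b0; have /andP[m0 m1] := beta_mean01 a0 b0.
have iw := integrable_beta_kernel a0 b0.
have im : mu.-integrable `]0, (a / (a + b))[ (EFin \o beta_kernel a b).
  by apply: integrableS iw => //; apply: subset_itvl; rewrite bnd_simp ltW.
rewrite [X in _ = X + _](Rintegral_itv_bndo_bndc im).
by rewrite -(@Rintegral_itvB _ _ (BRight 0) (BLeft 1) _ iw) ?bnd_simp ?ltW// subrKC.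
Qed.

Lemma beta_above_meanE (a b : R) : 0 < a -> 0 < b ->
  (\int[mu]_(x in `](a / (a + b)), 1[) beta_kernel a b x) / Beta a b =
  1 - (\int[mu]_(x in `]0, (a / (a + b))[) beta_kernel a b x) / Beta a b.
Proof.
move=> a0 b0; have B0 : Beta a b != 0 by rewrite gt_eqF// Beta_gt0.
apply: (mulIf B0); rewrite mulrBl !divfK// mul1r.
by apply/esym/eqP; rewrite subr_eq [X in _ == X]addrC; apply/eqP; exact: beta_kernel_split_mean.
Qed.

(** Reflection sends (m,1) to (0,1-m), and [1 - m = b / (b + a)] is the mean for the exchanged
    parameters. The upper tail thus becomes a lower ratio whose first parameter is [b]. *)
Lemma beta_above_mean_sym (a b : R) : 0 < a -> 0 < b ->
  (\int[mu]_(x in `](a / (a + b)), 1[) beta_kernel a b x) / Beta a b =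
  (\int[mu]_(x in `]0, (b / (b + a))[) beta_kernel b a x) / Beta b a.
Proof.
move=> a0 b0.
rewrite integral_beta_kernel_onem [Beta a b](integral_beta_kernel_onem a b 0 1) subrr subr0.
have -> : 1 - a / (a + b) = b / (b + a) by field; rewrite !gt_eqF// addr_gt0.
by [].
Qed.

End beta_distribution.

Unset Implicit Arguments.

Theorem corollary7 (R : realType)
    (d : R -> R -> measure_display)
    (T : forall a b : R, measurableType (d a b))
    (P : forall a b : R, probability (T a b) R)
    (X : forall a b : R, {RV (P a b) >-> R})
    (hX : forall a b : R, 0 < a -> 0 < b -> Beta_distributed (X a b) a b) :
  (forall b a1 a2 : R, 0 < b -> 0 < a1 -> a1 <= a2 ->
    (prob_ge_mean (X a1 b) <= prob_ge_mean (X a2 b))%E) /\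
  (forall a b1 b2 : R, 0 < a -> 0 < b1 -> b1 <= b2 ->
    (prob_ge_mean (X a b2) <= prob_ge_mean (X a b1))%E).
Proof.
have PE a b (a0 : 0 < a) (b0 : 0 < b) := prob_ge_mean_Beta a0 b0 (hX a b a0 b0).
split=> [b a1 a2 b0 a10 a12|a b1 b2 a0 b10 b12].
  have a20 := lt_le_trans a10 a12.
  rewrite (PE _ _ a10 b0) (PE _ _ a20 b0) lee_fin.
  rewrite (beta_above_meanE a10 b0) (beta_above_meanE a20 b0).
  (* In [a], the probability is 1 minus the nonincreasing lower ratio. *)
  by apply: lerB; [exact: lexx|exact: beta_below_mean_nonincreasing].
(* In [b], reflection makes the probability itself a lower ratio with [b] as first parameter. *)
have b20 := lt_le_trans b10 b12.
rewrite (PE _ _ a0 b10) (PE _ _ a0 b20) lee_fin.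
rewrite (beta_above_mean_sym a0 b10) (beta_above_mean_sym a0 b20).
exact: beta_below_mean_nonincreasing.
Qed.
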